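(* Let $0<\delta<1$, let $n\ge 1$ be an integer, and let $m$ be a positive integer with $m>\dfrac{2\ln n}{\delta^2}$. Then for every $N\geq 1$ and every set $\mathbf{X}\subset\mathbb{S}^{N-1}$ of cardinality $n$ there is a $\delta$-RIP map from $\mathbf{X}$ into $\mathbb{H}_m$; that is, there is a map $f:\mathbf{X}\to\mathbb{H}_m$ such that $$|d_{\mathbb{H}_m}(f(x),f(y))-d_{geo}(x,y)|\leq\delta\quad\text{for all } x,y\in\mathbf{X}.$$
   Context: $\mathbb{S}^{N-1}$ is the unit sphere of $\mathbb{R}^N$, with normalized geodesic metric $d_{geo}(x,y)=\frac{\cos^{-1}(x\cdot y)}{\pi}$ (antipodal points are at distance one). $\mathbb{H}_m=\{0,1\}^m$ is the Hamming cube with normalized Hamming metric $d_{\mathbb{H}_m}(u,v)=\frac1m\#\{i:u_i\neq v_i\}$. *)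

(* Defs.v *)
From mathcomp Require Import all_boot all_order all_algebra.
From mathcomp Require Import finmap.
From mathcomp Require Import all_classical all_reals all_analysis.

Set Implicit Arguments.
Unset Strict Implicit.
Unset Printing Implicit Defensive.

Import Order.TTheory GRing.Theory Num.Theory.

Local Open Scope classical_set_scope.
Local Open Scope ring_scope.

Definition dotp (R : realType) (N : nat) (x y : 'rV[R]_N) : R :=
  \sum_(i < N) x 0 i * y 0 i.

(* The library norm on 'rV[R]_N is the sup norm, hence this definition. *)
Definition eucl_norm (R : realType) (N : nat) (x : 'rV[R]_N) : R :=
  Num.sqrt (dotp x x).

(* The unit sphere of R^N, i.e. the sphere of dimension N - 1. *)
Definition unit_sphere (R : realType) (N : nat) : set 'rV[R]_N :=
  [set x | eucl_norm x = 1].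
Arguments unit_sphere R N : clear implicits.

(* Meaningful only for x and y in the unit sphere. *)
Definition geo_dist (R : realType) (N : nat) (x y : 'rV[R]_N) : R :=
  acos (dotp x y) / pi.

Definition hamming_cube (m : nat) := m.-tuple bool.

Definition hamming_dist (R : realType) (m : nat) (u v : hamming_cube m) : R :=
  #|[set i : 'I_m | tnth u i != tnth v i]%SET|%:R / m%:R.
Arguments hamming_dist R {m} u v.

Definition is_RIP (R : realType) (A B : Type)
    (dA : A -> A -> R) (dB : B -> B -> R) (delta : R) (f : A -> B) : Prop :=
  forall x y : A, `|dB (f x) (f y) - dA x y| <= delta.

(* Main.v *)
Require Import Defs.
From mathcomp Require Import all_boot all_order all_algebra.
From mathcomp Require Import finmap.
From mathcomp Require Import all_classical all_reals all_analysis.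
From mathcomp Require Import zify ring lra.

Set Implicit Arguments.
Unset Strict Implicit.
Unset Printing Implicit Defensive.

Import Order.TTheory GRing.Theory Num.Theory.
Import numFieldNormedType.Exports.

Local Open Scope fset_scope.
Local Open Scope classical_set_scope.
Local Open Scope ring_scope.

(** A random hyperplane through the origin separates two unit vectors [x] and
    [y] with probability [acos (x . y) / pi].  The signs of [x] with respect to
    [m] independent random hyperplanes therefore form a point of the Hamming
    cube, and the Hamming distance of two such points is an average of [m]
    independent Bernoulli variables whose mean is the geodesic distance.  By
    Hoeffding's inequality a given pair of points is distorted by more than
    [delta] with probability at most [2 exp (- 2 m delta^2) < 2 / n^4], and a
    union bound over the pairs yields a good choice of hyperplanes
    ([hoeffding_bernoulli], [hoeffding_tail], [exists_empirical_frequencies]).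

    Only finitely many sign patterns occur on a finite set, so the random normal
    vector need not come from a countably additive measure.  Here it is a lattice
    point, drawn from a finitely additive probability [mu] on all subsets of
    [Z^N] ([exists_lattice_mean]): the limit along a free ultrafilter of the
    uniform probabilities on Euclidean balls whose radii are so chosen that
    enlarging the [j]-th ball by [j] adds only a fraction [1/j] of its points.
    Such a [mu] is invariant under every injection of [Z^N] that increases norms
    by a bounded amount.  Translations are of this kind, so strips around
    hyperplanes are null ([mean_strip]).  A rotation in a coordinate plane is a
    product of three transvections, and rounding a transvection gives an
    injection of [Z^N] at bounded distance from it; hence the probability of
    separation is invariant under these rotations ([sep_isometry]).  They bring
    any two unit vectors into a coordinate plane ([pair_normal_form]), where the
    probability of separation is additive along arcs and equal to [1] for
    antipodal points, hence proportional to the angle ([sep_arc],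
    [sep_geo_dist]). *)

(** * Euclidean geometry of row vectors *)

Lemma dotpC (R : realType) N (x y : 'rV[R]_N) : dotp x y = dotp y x.
Proof. by apply: eq_bigr => i _; rewrite mulrC. Qed.

Lemma dotpDl (R : realType) N (x y z : 'rV[R]_N) :
  dotp (x + y) z = dotp x z + dotp y z.
Proof. by rewrite /dotp -big_split; apply: eq_bigr => i _; rewrite !mxE mulrDl. Qed.

Lemma dotpZl (R : realType) N a (x y : 'rV[R]_N) :
  dotp (a *: x) y = a * dotp x y.
Proof. by rewrite /dotp mulr_sumr; apply: eq_bigr => i _; rewrite !mxE mulrA. Qed.

Lemma dotpDr (R : realType) N (x y z : 'rV[R]_N) :
  dotp z (x + y) = dotp z x + dotp z y.
Proof. by rewrite dotpC dotpDl !(dotpC z). Qed.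

Lemma dotpZr (R : realType) N a (x y : 'rV[R]_N) :
  dotp x (a *: y) = a * dotp x y.
Proof. by rewrite dotpC dotpZl dotpC. Qed.

Lemma dotpNl (R : realType) N (x y : 'rV[R]_N) : dotp (- x) y = - dotp x y.
Proof. by rewrite -scaleN1r dotpZl mulN1r. Qed.

Lemma dotpNr (R : realType) N (x y : 'rV[R]_N) : dotp x (- y) = - dotp x y.
Proof. by rewrite dotpC dotpNl dotpC. Qed.

Lemma dotpBl (R : realType) N (x y z : 'rV[R]_N) :
  dotp (x - y) z = dotp x z - dotp y z.
Proof. by rewrite dotpDl dotpNl. Qed.

Lemma dotp_delta (R : realType) N (x : 'rV[R]_N) i : dotp x (delta_mx 0 i) = x 0 i.
Proof.
rewrite /dotp (bigD1 i) //= big1 => [|j ji]; rewrite mxE eqxx ?eqxx ?mulr1 ?addr0 //.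
by rewrite (negbTE ji) mulr0.
Qed.

Lemma dotp_ge0 (R : realType) N (x : 'rV[R]_N) : 0 <= dotp x x.
Proof. by apply: sumr_ge0 => i _; rewrite -expr2 sqr_ge0. Qed.

Lemma eucl_norm_ge0 (R : realType) N (x : 'rV[R]_N) : 0 <= eucl_norm x.
Proof. exact: sqrtr_ge0. Qed.

Lemma sqr_eucl_norm (R : realType) N (x : 'rV[R]_N) : eucl_norm x ^+ 2 = dotp x x.
Proof. by rewrite sqr_sqrtr // dotp_ge0. Qed.

Lemma eucl_norm0_eq0 (R : realType) N (x : 'rV[R]_N) : eucl_norm x = 0 -> x = 0.
Proof.
move=> x0; apply/rowP => i; rewrite mxE; apply/eqP.
have : dotp x x == 0 by rewrite -sqr_eucl_norm x0 expr0n.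
rewrite psumr_eq0 => [|j _]; last by rewrite -expr2 sqr_ge0.
by move/allP => /(_ i); rewrite mem_index_enum mulf_eq0 orbb; apply.
Qed.

Lemma eucl_normZ (R : realType) N a (x : 'rV[R]_N) :
  eucl_norm (a *: x) = `|a| * eucl_norm x.
Proof.
rewrite /eucl_norm dotpZl dotpZr mulrA -expr2 sqrtrM ?sqr_ge0 //.
by rewrite sqrtr_sqr.
Qed.

Lemma eucl_norm_delta (R : realType) N (i : 'I_N) :
  eucl_norm (delta_mx 0 i : 'rV[R]_N) = 1.
Proof. by rewrite /eucl_norm dotp_delta mxE !eqxx sqrtr1. Qed.

Lemma cauchy_schwarz_dotp (R : realType) N (x y : 'rV[R]_N) :
  `|dotp x y| <= eucl_norm x * eucl_norm y.
Proof.
have [y0|yn0] := eqVneq (eucl_norm y) 0.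
  rewrite (eucl_norm0_eq0 y0) -(scale0r 0) dotpZr mul0r normr0.
  by rewrite mulr_ge0 ?eucl_norm_ge0.
rewrite -(@ler_pXn2r _ 2) ?nnegrE ?normr_ge0 ?mulr_ge0 ?eucl_norm_ge0 //.
rewrite exprMn !sqr_eucl_norm real_normK ?num_real //.
have yy0 : 0 < dotp y y.
  by rewrite -sqr_eucl_norm exprn_gt0 // lt_def yn0 eucl_norm_ge0.
have := dotp_ge0 (dotp y y *: x - dotp x y *: y).
rewrite !dotpDl !dotpDr !dotpNl !dotpNr !dotpZl !dotpZr (dotpC y x) => h.
rewrite -subr_ge0 -(pmulr_rge0 _ yy0); apply: le_trans h _.
by rewrite le_eqVlt; apply/orP; left; apply/eqP; ring.
Qed.

Lemma eucl_normD (R : realType) N (x y : 'rV[R]_N) :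
  eucl_norm (x + y) <= eucl_norm x + eucl_norm y.
Proof.
rewrite -(@ler_pXn2r _ 2) ?nnegrE ?addr_ge0 ?eucl_norm_ge0 //.
rewrite sqrrD !sqr_eucl_norm !dotpDl !dotpDr (dotpC y x).
have := le_trans (ler_norm _) (cauchy_schwarz_dotp x y).
move: (dotp x x) (dotp x y) (dotp y y) (_ * _) => a b c d h.
by rewrite mulr2n; lra.
Qed.

Lemma ler_coord_eucl_norm (R : realType) N (x : 'rV[R]_N) i : `|x 0 i| <= eucl_norm x.
Proof.
rewrite -dotp_delta; apply: le_trans (cauchy_schwarz_dotp _ _) _.
by rewrite eucl_norm_delta mulr1.
Qed.

(** * Balls of the integer lattice *)

(** The lattice point [g], seen as a real vector. *)
Definition lat (R : realType) N (g : 'rV[int]_N) : 'rV[R]_N := map_mx intr g.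
Arguments lat R {N} g.

Lemma latD (R : realType) N (g h : 'rV[int]_N) : lat R (g + h) = lat R g + lat R h.
Proof. by apply/rowP => i; rewrite !mxE intrD. Qed.

Lemma latZ (R : realType) N (a : int) (g : 'rV[int]_N) :
  lat R (a *: g) = a%:~R *: lat R g.
Proof. by apply/rowP => i; rewrite !mxE intrM. Qed.

Lemma lat_delta (R : realType) N (i : 'I_N) :
  lat R (delta_mx 0 i) = delta_mx 0 i.
Proof. by apply/rowP => j; rewrite !mxE; case: (_ && _). Qed.

Lemma lat0 (R : realType) N : lat R (0 : 'rV[int]_N) = 0.
Proof. by apply/rowP => j; rewrite !mxE. Qed.

(** The lattice points of sup norm at most [k]. *)
Definition lat_box N (k : nat) : {fset 'rV[int]_N} :=
  [fset map_mx (fun i : 'I_(2 * k).+1 => (i : nat)%:Z - k%:Z) M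
     | M in [set: 'rV['I_(2 * k).+1]_N]%SET].

(** The lattice points of Euclidean norm at most [k]. *)
Definition lat_ball (R : realType) N (k : nat) : {fset 'rV[int]_N} :=
  [fset g in lat_box N k | eucl_norm (lat R g) <= k%:R].
Arguments lat_ball R N k : clear implicits.

Lemma mem_lat_ball (R : realType) N k (g : 'rV[int]_N) :
  (g \in lat_ball R N k) = (eucl_norm (lat R g) <= k%:R).
Proof.
rewrite !inE; apply: andb_idl => gk.
have gi i : `|g 0 i| <= k%:Z.
  have := le_trans (ler_coord_eucl_norm (lat R g) i) gk.
  by rewrite mxE -intr_norm -[k%:R]/(k%:Z%:~R) ler_int.
apply/imfsetP => /=.
exists (\row_i inord (absz (g 0 i + k%:Z))); first by rewrite inE.
apply/rowP => i; rewrite !mxE inordK; have := gi i; lia.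
Qed.

Lemma card_lat_box N k : (#|` lat_box N k| <= (2 * k).+1 ^ N)%N.
Proof.
apply: leq_trans (leq_imfset_card _ _ _) _ => /=.
by rewrite -cardE cardsT card_mx mul1n card_ord.
Qed.

Lemma card_lat_ball (R : realType) N k : (#|` lat_ball R N k| <= (2 * k).+1 ^ N)%N.
Proof.
apply: leq_trans (card_lat_box N k); apply: fsubset_leq_card.
by apply/fsubsetP => g; rewrite !inE => /andP[].
Qed.

Lemma card_lat_ball_gt0 (R : realType) N k : (0 < #|` lat_ball R N k|)%N.
Proof.
rewrite cardfs_gt0; apply/fset0Pn; exists 0.
rewrite mem_lat_ball lat0 -(scale0r (0 : 'rV[R]_N)) eucl_normZ normr0 mul0r.
exact: ler0n.
Qed.

(** * An asymptotically invariant mean on the lattice *)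

Lemma exp_gt_poly a N : exists M, ((a * M).+1 ^ N < 2 ^ M)%N.
Proof.
have [c ac] : exists c, (a.+1 <= 2 ^ c)%N by exists a; rewrite ltn_expl.
(* The witness is [2 ^ s], with [s] so large that [(c + s) * N < s ^ 2 <= 2 ^ s]. *)
pose s := (N * c + N + 4)%N.
have s2 : (s * s <= 2 ^ s)%N.
  rewrite /s; elim: (N * c + N)%N => [|k IH]; first by [].
  rewrite addSn expnS; apply: leq_trans (leq_mul (leqnn 2) IH); nia.
exists (2 ^ s)%N.
have le1 : ((a * 2 ^ s).+1 <= 2 ^ (c + s))%N.
  rewrite expnD; apply: leq_trans (leq_mul ac (leqnn (2 ^ s)%N)).
  by rewrite mulSn -add1n leq_add2r expn_gt0.
apply: (@leq_ltn_trans (2 ^ ((c + s) * N))).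
  rewrite expnM; move: le1; move: (_ ^ (c + s))%N (_.+1) => u v vu.
  by case: (N) => // N'; rewrite leq_exp2r.
rewrite ltn_exp2l //; apply: leq_trans s2.
rewrite /s; nia.
Qed.

(** A sequence of balls of polynomial growth has members whose [j]-th
    enlargement is larger only by a factor [1 + 1/j]: otherwise the growth
    along multiples of [j] would be exponential. *)
Lemma subexp_growth (b : nat -> nat) N : (forall k, (0 < b k)%N) ->
  (forall k, (b k <= (2 * k).+1 ^ N)%N) ->
  forall j, (0 < j)%N -> exists k, (j * b (k + j) <= j.+1 * b k)%N.
Proof.
move=> b0 bN j j0; apply: contrapT => /forallNP nk.
have lt k : (j.+1 * b k < j * b (k + j))%N by rewrite ltnNge; apply/negP/nk.
have le m : (j.+1 ^ m <= j ^ m * b (j * m))%N.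
  elim: m => [|m IH]; first by rewrite !expn0 mul1n b0.
  rewrite !expnS (mulnC j) -mulnA [(j * m.+1)%N]mulnS (addnC j).
  apply: leq_trans (leq_mul (leqnn (j ^ m)) (ltnW (lt _))).
  by rewrite mulnCA leq_mul2l IH orbT.
have [M hM] := exp_gt_poly (2 * (j * j)) N.
have := le (j * M)%N; rewrite !expnM leqNgt => /negP; apply.
(* the first two terms of the binomial expansion of [(j + 1) ^ j] *)
have h2 : (2 * j ^ j <= j.+1 ^ j)%N.
  case: j j0 {nk lt le hM} => // j _.
  rewrite -(addn1 j.+1) expnDn big_ord_recl /= big_ord_recl /= !bin0 bin1 subn0.
  rewrite subn1 /= !exp1n !muln1 mul1n -expnS.
  by rewrite addnA addnn -mul2n leq_addr.
have h3 : (2 ^ M * (j ^ j) ^ M <= (j.+1 ^ j) ^ M)%N.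
  by rewrite -expnMn; case: (M) => // M'; rewrite leq_exp2r.
apply: leq_trans h3; rewrite mulnC ltn_pmul2r ?expn_gt0 ?j0 //.
by apply: leq_ltn_trans (bN _) _; rewrite !mulnA in hM *.
Qed.

(** The limit along a free ultrafilter: a positive and additive functional on the
    sequences in [[0, 1]], monotone for the order up to eventual errors
    [1 / (j + 1)]. *)
Lemma banach_limit (R : realType) : exists L : (nat -> R) -> R,
  (forall u, (forall j, 0 <= u j <= 1) -> 0 <= L u) /\
  (forall c, L (fun=> c) = c) /\
  (forall u v, (forall j, 0 <= u j <= 1) -> (forall j, 0 <= v j <= 1) ->
     L (fun j => u j + v j) = L u + L v) /\
  (forall u v, (forall j, 0 <= u j <= 1) -> (forall j, 0 <= v j <= 1) ->
     forall C : nat, (forall j, (C <= j)%N -> u j <= v j + j.+1%:R^-1) ->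
     L u <= L v).
Proof.
have [U [UU leU]] := @ultraFilterLemma nat (nbhs \oo) _.
have cv (u : nat -> R) : (forall j, 0 <= u j <= 1) -> u @ U --> lim (u @ U).
  move=> u01; apply/cvg_ex.
  have : compact `[(0 : R), 1] by exact: segment_compact.
  rewrite compact_ultra => /(_ (u @ U)).
  have uU : UltraFilter (u @ U).
    split; first exact: fmap_proper_filter.
    move=> G GF leG; apply/seteqP; split => // A GA.
    have [//|UA] := in_ultra_setVsetC (u @^-1` A) UU.
    have : G (~` A) by exact: leG.
    move=> /(filterI GA); rewrite setICr => /filter_ex [] //.
  case/(_ uU).
    have : U (u @^-1` `[0, 1]) by apply: filterS filterT => j _ /=; rewrite in_itv /=.
    by [].
  by move=> l [_ ul]; exists l.
exists (fun u => lim (u @ U)); split; [|split; [|split]].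
- move=> u u01; apply: limr_ge; first by apply/cvg_ex; eexists; exact: cv.
  by apply: filterS filterT => j _; have /andP[] := u01 j.
- by move=> c; apply: cvg_lim => //; exact: cvg_cst.
- by move=> u v u01 v01; apply: cvg_lim => //; apply: cvgD; exact: cv.
- move=> u v u01 v01 C uv.
  have c0 : (fun j => j.+1%:R^-1 : R) @ U --> (0 : R).
    by move=> A /(@cvg_harmonic R) /leU.
  rewrite -[leRHS]addr0.
  apply: (ler_cvg_to (cv u u01) (cvgD (cv v v01) c0)).
  apply: leU; exists C => // j /= Cj; exact: uv.
Qed.

(** A finitely additive probability on all subsets of the integer lattice that
    is invariant under the injections which increase the Euclidean norm by a
    bounded amount only. *)
Record lattice_mean (R : realType) N (mu : set 'rV[int]_N -> R) : Prop :=
  LatticeMean {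
  mean_ge0 : forall A, 0 <= mu A;
  meanT : mu setT = 1;
  meanU : forall A B, A `&` B = set0 -> mu (A `|` B) = mu A + mu B;
  mean_preimage : forall (T : 'rV[int]_N -> 'rV[int]_N) (C : nat),
    injective T ->
    (forall g, eucl_norm (lat R (T g)) <= eucl_norm (lat R g) + C%:R) ->
    forall A, mu (T @^-1` A) = mu A }.

(** The limit of the uniform probabilities on the balls selected by
    [subexp_growth].  An injection [T] as in [mean_preimage] maps the preimage of
    [A] in a ball into the part of [A] in an enlarged ball; the opposite
    inequality is the same statement for the complement of [A]. *)
Lemma exists_lattice_mean (R : realType) N :
  exists mu : set 'rV[int]_N -> R, lattice_mean mu.
Proof.
have [B [memB [B0 BN]]] : exists B : nat -> {fset 'rV[int]_N},
    (forall k g, (g \in B k) = (eucl_norm (lat R g) <= k%:R)) /\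
    (forall k, (0 < #|` B k|)%N) /\
    (forall k, (#|` B k| <= (2 * k).+1 ^ N)%N).
  exists (lat_ball R N); split; first by move=> k g; exact: mem_lat_ball.
  by split => k; [exact: card_lat_ball_gt0 | exact: card_lat_ball].
have [kap Hkap] : exists kap : nat -> nat,
    forall j, (j.+1 * #|` B (kap j + j.+1)%N| <= j.+2 * #|` B (kap j)|)%N.
  have h j : exists k, (j.+1 * #|` B (k + j.+1)%N| <= j.+2 * #|` B k|)%N.
    exact: (subexp_growth B0 BN).
  by exists (fun j => projT1 (cid (h j))) => j; exact: (projT2 (cid (h j))).
pose cnt (A : set 'rV[int]_N) k := #|` [fset g in B k | g \in A]|.
have cntB A k : (cnt A k <= #|` B k|)%N.
  by apply/fsubset_leq_card/fsubsetP => g; rewrite !inE => /andP[].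
have cntT k : cnt setT k = #|` B k|.
  by congr #|` _|; apply/fsetP => g; rewrite !inE in_setT andbT.
have cntU A A' k : A `&` A' = set0 -> cnt (A `|` A') k = (cnt A k + cnt A' k)%N.
  move=> AA'; rewrite /cnt -cardfsUI.
  have -> : ([fset g in B k | g \in A] `&` [fset g in B k | g \in A'])%fset = fset0.
    apply/fsetP => g; rewrite !inE; apply/negP => /andP[/andP[_ gA] /andP[_ gA']].
    have : (A `&` A') g by split; exact: set_mem.
    by rewrite AA'.
  rewrite cardfs0 addn0; congr #|` _|; apply/fsetP => g.
  by rewrite !inE in_setU andb_orr.
pose P A j : R := (cnt A (kap j))%:R / #|` B (kap j)|%:R.
have Bp j : 0 < #|` B (kap j)|%:R :> R by rewrite ltr0n.
have P01 A j : 0 <= P A j <= 1.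
  by rewrite divr_ge0 ?ler0n //= ler_pdivrMr // mul1r ler_nat.
have [L [L0 [Lc [LD Lle]]]] := banach_limit R.
exists (fun A => L (P A)).
have LU A A' : A `&` A' = set0 -> L (P (A `|` A')) = L (P A) + L (P A').
  move=> AA'; rewrite -LD //; congr L; apply/funext => j.
  by rewrite /P cntU // natrD mulrDl.
have LT : L (P setT) = 1.
  rewrite -[RHS]Lc; congr L; apply/funext => j.
  by rewrite /P cntT divff // gt_eqF.
have LC A : L (P (~` A)) = 1 - L (P A).
  by rewrite -LT -(setUv A) LU ?setICr // addrC addKr.
split => // [A|T C Tinj TC A]; first exact: L0.
have le A' : L (P (T @^-1` A')) <= L (P A').
  apply: (Lle _ _ (P01 _) (P01 _) C) => j Cj.
  have le1 : (cnt (T @^-1` A') (kap j) <= cnt A' (kap j + j.+1))%N.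
    rewrite {1}/cnt; set D := [fset _ in _ | _].
    have <- : #|` [fset T g | g in D]| = #|` D| by rewrite card_imfset.
    rewrite /D.
    apply/fsubset_leq_card/fsubsetP => h /imfsetP [g /=].
    rewrite !inE /= !memB => /andP[gB gA] ->.
    rewrite -in_setE in_setE; apply/andP; split; last first.
      by apply/mem_set; exact: (set_mem gA).
    apply: le_trans (TC g) _; rewrite natrD lerD // ler_nat; exact: ltnW.
  have le2 : (cnt A' (kap j + j.+1) + #|` B (kap j)|
              <= cnt A' (kap j) + #|` B (kap j + j.+1)|)%N.
    have sub : (B (kap j) `<=` B (kap j + j.+1)%N)%fset.
      apply/fsubsetP => g; rewrite !memB => /le_trans; apply.
      by rewrite ler_nat leq_addr.
    rewrite -(cntT (kap j)) -(cntT (kap j + j.+1)%N) -(setUv A').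
    rewrite !cntU ?setICr // addnCA !leq_add2l.
    apply/fsubset_leq_card/fsubsetP => g; rewrite !inE => /andP[gB ->].
    by rewrite (fsubsetP sub).
  have le3 := Hkap j.
  rewrite /P ler_pdivrMr // mulrDl divfK ?gt_eqF // mulrC.
  rewrite -(ler_pM2l (ltr0n R j.+1)) mulrDr mulrCA divff ?pnatr_eq0 // mulr1.
  rewrite -!natrM -natrD ler_nat; nia.
apply/eqP; rewrite eq_le le /=.
by have := le (~` A); rewrite preimage_setC !LC; lra.
Qed.

Lemma exists_nat_ge (R : realType) (r : R) : exists C : nat, r <= C%:R.
Proof.
exists (Num.bound `|r|); apply: le_trans (ler_norm r) _.
exact: ltW (archi_boundP (normr_ge0 r)).
Qed.

Section MeanTheory.
Context (R : realType) (N : nat) (mu : set 'rV[int]_N -> R).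
Hypothesis mumean : lattice_mean mu.
Implicit Types (A B E : set 'rV[int]_N) (x y : 'rV[R]_N).

Lemma mean_set0 : mu set0 = 0.
Proof. by have := meanU mumean (set0I set0); rewrite setU0; lra. Qed.

Lemma meanC A : mu (~` A) = 1 - mu A.
Proof.
by rewrite -(meanT mumean) -(setUv A) (meanU mumean) ?setICr // addrC addKr.
Qed.

Lemma mean_le A B : A `<=` B -> mu A <= mu B.
Proof.
move=> AB; rewrite -(setDUK AB) (meanU mumean) ?setDIK // lerDl; exact: mean_ge0.
Qed.

Lemma mean_le1 A : mu A <= 1.
Proof. by rewrite -(meanT mumean); apply: mean_le. Qed.

Lemma mean_setU_le A B : mu (A `|` B) <= mu A + mu B.
Proof.
rewrite -(setDUK (@subsetUl _ A B)) (meanU mumean) ?setDIK // lerD2l.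
by apply: mean_le => g [[]].
Qed.

Lemma mean_setU_null A B : mu A = 0 -> mu B = 0 -> mu (A `|` B) = 0.
Proof.
move=> A0 B0; apply/eqP; rewrite eq_le (mean_ge0 mumean) andbT.
by have := mean_setU_le A B; rewrite A0 B0 addr0.
Qed.

Lemma mean_eq_off_null E A B : mu E = 0 ->
  (forall g, ~ E g -> (A g <-> B g)) -> mu A = mu B.
Proof.
move=> E0; have le X Y : (forall g, ~ E g -> (X g -> Y g)) -> mu X <= mu Y.
  move=> XY; have le1 : X `<=` Y `|` E.
    by move=> g Xg; have [?|nE] := pselect (E g); [right|left; exact: XY].
  by apply: le_trans (mean_le le1) _; have := mean_setU_le Y E; rewrite E0 addr0.
by move=> AB; apply/eqP; rewrite eq_le !le // => g /AB [].
Qed.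

Lemma mean_disjoint_sum (F : nat -> set 'rV[int]_N) K :
  (forall k l g, F k g -> F l g -> k = l) ->
  mu [set g | exists2 k, (k < K)%N & F k g] = \sum_(k < K) mu (F k).
Proof.
move=> Finj; elim: K => [|K IH].
  rewrite big_ord0 -mean_set0; congr mu; apply/seteqP; split => // g [k] //.
rewrite big_ord_recr /= -IH -(meanU mumean).
  congr mu; apply/seteqP; split => g /=.
    move=> [k]; rewrite ltnS leq_eqVlt => /orP[/eqP-> ?|? ?]; first by right.
    by left; exists k.
  by move=> [[k kK Fk]|FK]; [exists k => //; exact: ltnW|exists K].
apply/seteqP; split => // g [[k kK Fk] FK] /=.
by move: kK; rewrite (Finj _ _ _ Fk FK) ltnn.
Qed.

(** Many translates of a strip are pairwise disjoint, and they all have the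
    same mean. *)
Lemma mean_strip x c : x != 0 ->
  mu [set g | `|dotp (lat R g) x| <= c] = 0.
Proof.
move=> x0; set A := [set g | _].
have [i xi] : exists i, x 0 i != 0.
  apply/existsP; apply: contraNT x0 => /existsPn h.
  by apply/eqP/rowP => i; rewrite mxE; apply/eqP; have := h i; rewrite negbK.
have [L Lx] : exists L : nat, 2 * c < L%:R * `|x 0 i|.
  have [L hL] := exists_nat_ge (2 * c / `|x 0 i|); exists L.+1.
  rewrite -ltr_pdivrMr ?normr_gt0 //; apply: le_lt_trans hL _.
  by rewrite ltr_nat.
pose h k : 'rV[int]_N := (k * L)%N%:Z *: delta_mx 0 i.
pose T k (g : 'rV[int]_N) := g + h k.
have dotT k g : dotp (lat R (T k g)) x = dotp (lat R g) x + (k * L)%N%:R * x 0 i.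
  by rewrite /T latD latZ lat_delta dotpDl dotpZl (dotpC (delta_mx _ _)) dotp_delta.
have muT k : mu (T k @^-1` A) = mu A.
  have [C hC] := exists_nat_ge (eucl_norm (lat R (h k))).
  apply: (mean_preimage mumean (C := C)); first exact: addIr.
  by move=> g; rewrite latD; apply: le_trans (eucl_normD _ _) _; rewrite lerD2l.
have disj k l g : (T k @^-1` A) g -> (T l @^-1` A) g -> k = l.
  wlog kl : k l / (k <= l)%N.
    by move=> W Hk Hl; case/orP: (leq_total k l) => ?; [|apply/esym]; exact: W.
  rewrite /A /= !dotT => Hk Hl; apply/eqP; rewrite eqn_leq kl /= leqNgt.
  apply/negP => lk.
  have : `|(l - k)%N%:R * L%:R * x 0 i| <= 2 * c.
    have -> : (l - k)%N%:R * L%:R * x 0 i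
      = (dotp (lat R g) x + (l * L)%:R * x 0 i)
        - (dotp (lat R g) x + (k * L)%:R * x 0 i).
      by rewrite natrB // !natrM; ring.
    by apply: le_trans (ler_normB _ _) _; lra.
  rewrite leNgt => /negP; apply; apply: (lt_le_trans Lx).
  rewrite 2!normrM !normr_nat -mulrA -[leLHS]mul1r ler_wpM2r ?mulr_ge0 //.
  by rewrite ler1n subn_gt0.
have bound K : K%:R * mu A <= 1.
  have := mean_disjoint_sum K disj.
  under eq_bigr do rewrite muT.
  rewrite sumr_const card_ord -[_ *+ _]mulr_natl => <-; exact: mean_le1.
apply/eqP; rewrite eq_le (mean_ge0 mumean) andbT leNgt; apply/negP => A0.
have [K hK] := exists_nat_ge (mu A)^-1.
have := bound K.+1; rewrite leNgt => /negP; apply.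
rewrite -ltr_pdivrMr // div1r; apply: le_lt_trans hK _; by rewrite ltr_nat.
Qed.

End MeanTheory.

(** * Plane rotations and the lattice *)

(** The map [rho] is Lipschitz and, on lattice points, stays at bounded distance
    from an injection [T] of the lattice into itself. *)
Definition lattice_approximable (R : realType) N (rho : 'rV[R]_N -> 'rV[R]_N) :=
  exists T C K, [/\ injective T, 0 <= K,
    forall g, eucl_norm (lat R (T g) - rho (lat R g)) <= C &
    forall x y, eucl_norm (rho x - rho y) <= K * eucl_norm (x - y)].

Lemma lattice_approximable_id (R : realType) N :
  lattice_approximable (fun x : 'rV[R]_N => x).
Proof.
exists id, 0, 1; split=> // g; last by move=> y; rewrite mul1r.
by rewrite subrr -(scale0r 0) eucl_normZ normr0 mul0r.
Qed.

Lemma lattice_approximable_comp (R : realType) N (r1 r2 : 'rV[R]_N -> 'rV[R]_N) :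
  lattice_approximable r1 -> lattice_approximable r2 ->
  lattice_approximable (fun x => r2 (r1 x)).
Proof.
move=> [T1 [C1 [K1 [i1 k1 a1 l1]]]] [T2 [C2 [K2 [i2 k2 a2 l2]]]].
exists (T2 \o T1), (C2 + K2 * C1), (K2 * K1); split.
- exact: inj_comp.
- exact: mulr_ge0.
- move=> g /=; rewrite -(subrKA (r2 (lat R (T1 g)))).
  apply: le_trans (eucl_normD _ _) (lerD (a2 _) _).
  exact: le_trans (l2 _ _) (ler_wpM2l k2 (a1 g)).
- move=> x y; apply: le_trans (l2 _ _) _.
  by rewrite -mulrA; apply: ler_wpM2l.
Qed.

(** The transvection adding [t] times the coordinate [j] to the coordinate
    [i]. *)
Definition shear (R : realType) N (i j : 'I_N) (t : R) (x : 'rV[R]_N) : 'rV[R]_N :=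
  x + (t * x 0 j) *: delta_mx 0 i.

(** Rounding the added multiple keeps a transvection injective on the
    lattice. *)
Lemma lattice_approximable_shear (R : realType) N (i j : 'I_N) (t : R) : i != j ->
  lattice_approximable (shear i j t).
Proof.
move=> ij.
exists (fun g : 'rV[int]_N => g + Num.floor (t * (g 0 j)%:~R) *: delta_mx 0 i), 1, (1 + `|t|).
split.
- move=> g h /rowP gh.
  have ghj : g 0 j = h 0 j.
    by have := gh j; rewrite !mxE eq_sym (negbTE ij) /= !mulr0 !addr0.
  by apply: (addIr (Num.floor (t * (g 0 j)%:~R) *: delta_mx 0 i)); apply/rowP => k;
    have := gh k; rewrite ghj.
- by rewrite addr_ge0.
- move=> g; rewrite latD latZ lat_delta /shear opprD addrACA subrr add0r -scalerBl eucl_normZ.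
  rewrite eucl_norm_delta mulr1 mxE distrC ger0_norm.
    by rewrite lerBlDr addrC ltW // -[1]/(1%:~R) -intrD floorD1_gt.
  by rewrite subr_ge0 ge_floor.
- move=> x y; rewrite /shear.
  have -> : x + (t * x 0 j) *: delta_mx 0 i - (y + (t * y 0 j) *: delta_mx 0 i)
    = (x - y) + (t * (x - y) 0 j) *: delta_mx 0 i.
    by rewrite !mxE mulrBr scalerBl opprD addrACA.
  apply: le_trans (eucl_normD _ _) _.
  rewrite mulrDl mul1r lerD2l eucl_normZ eucl_norm_delta mulr1 normrM.
  by rewrite ler_wpM2l // ler_coord_eucl_norm.
Qed.

(** The linear map [(x_i, x_j) |-> (c x_i + s x_j, c x_j - s x_i)] in the
    coordinates [i] and [j]; a rotation when [c ^+ 2 + s ^+ 2 = 1]. *)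
Definition givens (R : realType) N (i j : 'I_N) (c s : R) (x : 'rV[R]_N) : 'rV[R]_N :=
  \row_k (if k == i then c * x 0 i + s * x 0 j
          else if k == j then c * x 0 j - s * x 0 i else x 0 k).

(** Every plane rotation other than the half-turn is the product of three
    transvections; here [s / (1 + c)] is the tangent of half the angle. *)
Lemma givens_shear (R : realType) N (i j : 'I_N) (c s : R) : i != j ->
  c ^+ 2 + s ^+ 2 = 1 -> c != -1 -> forall x,
  givens i j c s x =
  shear i j (s / (1 + c)) (shear j i (- s) (shear i j (s / (1 + c)) x)).
Proof.
move=> ij cs c1 x.
have c10 : 1 + c != 0 by rewrite addrC addr_eq0.
set t := s / (1 + c).
have st : s * t = 1 - c.
  by rewrite /t; apply: (mulIf c10); rewrite mulrA divfK // -expr2; lra.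
have ct : c * t = s - t by rewrite /t; field.
apply/rowP => k; rewrite !mxE !eqxx (eq_sym j i) (negbTE ij) /=.
case: (eqVneq k i) => [->|ki]; rewrite ?mulr0 ?mulr1 ?addr0.
  rewrite (negbTE ij) /= !mulr0 !addr0.
  have -> : x 0 i + t * x 0 j + t * (x 0 j + - s * (x 0 i + t * x 0 j))
    = (1 - s * t) * x 0 i + (t * (2 - s * t)) * x 0 j by ring.
  rewrite st; have -> : t * (2 - (1 - c)) = t + c * t by ring.
  by rewrite ct; ring.
case: (eqVneq k j) => [->|kj] /=; rewrite ?mulr0 ?mulr1 ?addr0 //.
have -> : x 0 j + - s * (x 0 i + t * x 0 j) = (1 - s * t) * x 0 j - s * x 0 i by ring.
by rewrite st; ring.
Qed.

Lemma lattice_approximable_givens (R : realType) N (i j : 'I_N) (c s : R) :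
  i != j -> c ^+ 2 + s ^+ 2 = 1 -> c != -1 -> lattice_approximable (givens i j c s).
Proof.
move=> ij cs c1.
rewrite (_ : givens i j c s = fun x =>
  shear i j (s / (1 + c)) (shear j i (- s) (shear i j (s / (1 + c)) x))); last first.
  by apply/funext => x; exact: givens_shear.
apply: (lattice_approximable_comp _ (lattice_approximable_shear _ ij)).
apply: lattice_approximable_comp; apply: lattice_approximable_shear => //.
by rewrite eq_sym.
Qed.

Lemma dotp_givens (R : realType) N (i j : 'I_N) (c s : R) : i != j ->
  c ^+ 2 + s ^+ 2 = 1 ->
  forall x y, dotp (givens i j c s x) (givens i j c s y) = dotp x y.
Proof.
move=> ij cs x y; rewrite /dotp (bigD1 i) // [RHS](bigD1 i) //=.
rewrite (bigD1 j) ?(eq_sym j i) // [X in _ = _ + X](bigD1 j) ?(eq_sym j i) //=.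
rewrite !mxE !eqxx (eq_sym j i) (negbTE ij) !addrA; congr (_ + _).
  have -> : (c * x 0 i + s * x 0 j) * (c * y 0 i + s * y 0 j) +
     (c * x 0 j - s * x 0 i) * (c * y 0 j - s * y 0 i) =
     (c ^+ 2 + s ^+ 2) * (x 0 i * y 0 i + x 0 j * y 0 j) by ring.
  by rewrite cs mul1r.
by apply: eq_bigr => k /andP[ki kj]; rewrite !mxE (negbTE ki) (negbTE kj).
Qed.

(** A lattice-approximable map preserving the scalar product. *)
Definition lattice_isometry (R : realType) N (rho : 'rV[R]_N -> 'rV[R]_N) :=
  lattice_approximable rho /\ forall x y, dotp (rho x) (rho y) = dotp x y.

Lemma lattice_isometry_comp (R : realType) N (r1 r2 : 'rV[R]_N -> 'rV[R]_N) :
  lattice_isometry r1 -> lattice_isometry r2 ->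
  lattice_isometry (fun x => r2 (r1 x)).
Proof.
move=> [a1 d1] [a2 d2]; split; first exact: lattice_approximable_comp.
by move=> x y; rewrite d2 d1.
Qed.

Lemma lattice_isometry_givens (R : realType) N (i j : 'I_N) (c s : R) :
  i != j -> c ^+ 2 + s ^+ 2 = 1 -> c != -1 -> lattice_isometry (givens i j c s).
Proof.
move=> ij cs c1; split; first exact: lattice_approximable_givens.
exact: dotp_givens.
Qed.

(** Plane rotations among the coordinates in [S] can make all but one of the
    coordinates of [y] in [S] vanish. *)
Lemma givens_elimination (R : realType) N (S : {set 'I_N}) (y : 'rV[R]_N) :
  exists rho : 'rV[R]_N -> 'rV[R]_N, [/\ lattice_isometry rho,
    forall z : 'rV[R]_N, (forall k, k \in S -> z 0 k = 0) -> rho z = z &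
    forall k l, k \in S -> l \in S -> rho y 0 k != 0 -> rho y 0 l != 0 -> k = l].
Proof.
have [n] := ubnP #|[set k in S | y 0 k != 0]%SET|.
elim: n y => // n IH y; rewrite ltnS => yn.
have [h|] := pselect (forall k l, k \in S -> l \in S ->
    y 0 k != 0 -> y 0 l != 0 -> k = l).
  exists id; split=> //; split=> //; exact: lattice_approximable_id.
move=> /existsNP[k] /existsNP[l] /not_implyP[kS] /not_implyP[lS].
move=> /not_implyP[yk] /not_implyP[yl] /eqP kl.
pose r := Num.sqrt (y 0 k ^+ 2 + y 0 l ^+ 2).
have r2 : r ^+ 2 = y 0 k ^+ 2 + y 0 l ^+ 2 by rewrite sqr_sqrtr // addr_ge0 ?sqr_ge0.
have r0 : r != 0.
  apply: contra_neq yl => r0; move: r2; rewrite r0 expr0n /= => /esym/eqP.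
  by rewrite paddr_eq0 ?sqr_ge0 // !sqrf_eq0 => /andP[_ /eqP].
pose c := y 0 k / r; pose s := y 0 l / r.
have cs : c ^+ 2 + s ^+ 2 = 1.
  by rewrite /c /s !expr_div_n -mulrDl -r2 divff // expf_neq0.
have s0 : s != 0 by rewrite mulf_neq0 ?invr_neq0.
have c1 : c != -1.
  apply: contra_neq s0 => c1; apply/eqP; rewrite -sqrf_eq0; apply/eqP.
  by move: cs; rewrite c1 sqrrN expr1n; lra.
have Gl : givens k l c s y 0 l = 0.
  rewrite mxE eq_sym (negbTE kl) eqxx /c /s.
  by rewrite mulrAC [X in _ - X]mulrAC (mulrC (y 0 l)) subrr.
have [|rho [ri rz ry]] := IH (givens k l c s y).
  apply: leq_trans yn; apply: proper_card; apply/properP; split.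
    apply/fintype.subsetP => q; rewrite !inE => /andP[qS]; rewrite qS /= mxE.
    by case: (eqVneq q k) => [->|_] //; case: (eqVneq q l) => [->|_].
  by exists l; rewrite !inE ?lS ?yl // Gl eqxx andbF.
exists (fun z => rho (givens k l c s z)); split => //.
  by apply: lattice_isometry_comp => //; exact: lattice_isometry_givens.
move=> z zS; rewrite rz => [|q qS].
  apply/rowP => q; rewrite mxE (zS k kS) (zS l lS) !mulr0 subr0 addr0.
  by case: (eqVneq q k) => [->|_]; rewrite ?(zS k kS) //; case: (eqVneq q l) => [->|_] //; rewrite (zS l lS).
by rewrite mxE (zS k kS) (zS l lS) (zS q qS) !mulr0 subr0 addr0 !if_same.
Qed.

(** Two vectors, the first one nonzero, are moved simultaneously to a coordinate
    axis and to a coordinate plane that contains it. *)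
Lemma pair_normal_form (R : realType) N (x y : 'rV[R]_N) :
  x != 0 ->
  exists (rho : 'rV[R]_N -> 'rV[R]_N) i a, [/\ lattice_isometry rho, rho x = a *: delta_mx 0 i &
    (exists b, rho y = b *: delta_mx 0 i) \/
    (exists j b c, [/\ i != j, c != 0 & rho y = b *: delta_mx 0 i + c *: delta_mx 0 j])].
Proof.
move=> x0.
have [r1 [r1i _ r1x]] := givens_elimination [set: 'I_N] x.
have [i xi] : exists i, r1 x 0 i != 0.
  apply: contrapT => /forallNP h.
  have : r1 x = 0 by apply/rowP => k; rewrite mxE; apply/eqP/negPn/negP/h.
  move=> r10; have : eucl_norm x = 0 by rewrite /eucl_norm -r1i.2 /eucl_norm r10
    -(scale0r 0) dotpZl mul0r sqrtr0.
  by move/eucl_norm0_eq0/eqP; rewrite (negbTE x0).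
have r1x' : r1 x = r1 x 0 i *: delta_mx 0 i.
  apply/rowP => k; rewrite !mxE eqxx /=; case: eqVneq => [->|ki]; first by rewrite mulr1.
  rewrite mulr0; apply/eqP; apply: contraNT ki => xk.
  by apply/eqP; apply: r1x.
(* rotations among the coordinates other than [i] fix the image of [x] *)
have [r2 [r2i r2z r2y]] := givens_elimination [set~ i] (r1 y).
exists (fun z => r2 (r1 z)), i, (r1 x 0 i); split.
- exact: lattice_isometry_comp.
- rewrite [LHS]r2z // => k; rewrite !inE => ki.
  by rewrite r1x' !mxE (negbTE ki) /= mulr0.
- have [[j [ji yj]]|h] := pselect (exists j, j != i /\ r2 (r1 y) 0 j != 0).
    right; exists j, (r2 (r1 y) 0 i), (r2 (r1 y) 0 j); split=> //.
      by rewrite eq_sym.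
    apply/rowP => k; rewrite !mxE eqxx /=.
    case: (eqVneq k i) => [->|ki].
      by rewrite eq_sym (negbTE ji) mulr1 mulr0 addr0.
    rewrite mulr0 add0r; case: eqVneq => [->|kj]; rewrite ?mulr1 // mulr0.
    apply/eqP; apply: contraNT kj => yk.
    by apply/eqP; apply: r2y; rewrite // !inE.
  left; exists (r2 (r1 y) 0 i); apply/rowP => k; rewrite !mxE eqxx /=.
  case: (eqVneq k i) => [->|ki]; first by rewrite mulr1.
  rewrite mulr0; apply/eqP; apply: contrapT => /negP yk.
  by apply: h; exists k.
Qed.

(** * The separation probability of two unit vectors *)

(** The lattice points that the hyperplane tests of [x] and [y] tell apart. *)
Definition sepset (R : realType) N (x y : 'rV[R]_N) : set 'rV[int]_N :=
  [set g | (0 <= dotp (lat R g) x) != (0 <= dotp (lat R g) y)].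

(** A map [f] on [[0, p]] that is nonnegative and additive, with [f p = 1], is
    linear. *)
Lemma additive_itv_linear (R : realType) (p : R) (f : R -> R) : 0 < p ->
  (forall a, 0 <= a <= p -> 0 <= f a) ->
  (forall a b, 0 <= a -> 0 <= b -> a + b <= p -> f (a + b) = f a + f b) ->
  f p = 1 -> forall a, 0 <= a <= p -> f a = a / p.
Proof.
move=> p0 f0 fD fp.
(* compare with multiples of [p / q] for large [q] *)
have lower a : 0 <= a <= p -> a / p <= f a.
  move=> /andP[a0 ap]; rewrite leNgt; apply/negP => lt.
  have [q hq] := exists_nat_ge (a / p - f a)^-1.
  have q0 : 0 < q.+1%:R :> R by rewrite ltr0n.
  have hq1 : (q.+1%:R)^-1 < a / p - f a.
    rewrite -[ltRHS]invrK ltf_pV2 ?posrE ?invr_gt0 ?subr_gt0 //.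
    by apply: le_lt_trans hq _; rewrite ltr_nat.
  pose h := p / q.+1%:R.
  have h0 : 0 < h by rewrite divr_gt0.
  have qh : q.+1%:R * h = p by rewrite /h mulrC divfK // gt_eqF.
  have fk k : (k <= q.+1)%N -> f (k%:R * h) = k%:R * f h.
    elim: k => [_|k IH kq].
      rewrite !mul0r; have := fD 0 0 (lexx _) (lexx _).
      by rewrite addr0 => /(_ (ltW p0)); lra.
    rewrite -natr1 !mulrDl !mul1r fD ?IH ?(ltnW kq) ?(ltW h0) //.
      by rewrite mulr_ge0 // ltW.
    by rewrite -qh -{2}(mul1r h) -mulrDl natr1 ler_pM2r // ler_nat.
  have fh : f h = q.+1%:R^-1.
    by apply: (mulfI (lt0r_neq0 q0)); rewrite -fk // qh fp divff // lt0r_neq0.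
  pose k := Num.truncn (a / h).
  have /andP[k1 k2] : k%:R <= a / h < k.+1%:R.
    by apply: truncn_itv; rewrite divr_ge0 // ltW.
  have ka : k%:R * h <= a by rewrite -ler_pdivlMr.
  have kq : (k <= q.+1)%N.
    by rewrite -(ler_nat R) -(ler_pM2r h0) qh; exact: le_trans ka ap.
  have le1 : k%:R / q.+1%:R <= f a.
    have -> : a = k%:R * h + (a - k%:R * h) by ring.
    have kh0 : 0 <= k%:R * h by rewrite mulr_ge0 // ltW.
    rewrite fD ?subr_ge0 // addrC ?subrK // addrC.
    by rewrite fk // fh lerDl f0 // subr_ge0 ka /= lerBlDr (le_trans ap) // lerDl.
  have le2 : a / p < k%:R / q.+1%:R + q.+1%:R^-1.
    rewrite ltr_pdivrMr // -[X in _ + X]mul1r -mulrDl natr1 mulrAC -mulrA.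
    by rewrite -/h -ltr_pdivrMr.
  move: hq1 le1 le2; move: (q.+1%:R^-1) (k%:R / _) (a / p) (f a) => r1 r2 r3 r4.
  lra.
move=> a /andP[a0 ap]; apply/eqP; rewrite eq_le lower ?a0 // andbT.
(* the upper bound is the lower bound at [p - a] *)
have := fD (p - a) a; rewrite subrK fp subr_ge0 lexx => /(_ ap a0 isT) h.
have : (p - a) / p <= f (p - a) by apply: lower; rewrite subr_ge0 ap lerBlDr lerDl.
by rewrite mulrBl divff ?gt_eqF //; lra.
Qed.

Lemma same_sign_near (R : realType) (u v d : R) :
  d < `|v| -> `|u - v| <= d -> (0 <= u) = (0 <= v).
Proof.
rewrite ler_norml; case: (ger0P v) => v0; case: (ger0P u) => u0 // dv /andP[h1 h2];
  exfalso; lra.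
Qed.

Section Separation.
Context (R : realType) (N : nat) (mu : set 'rV[int]_N -> R).
Hypothesis mumean : lattice_mean mu.
Implicit Types (x y z : 'rV[R]_N).

Lemma sep_refl x : mu (sepset x x) = 0.
Proof.
rewrite -(mean_set0 mumean); congr mu; apply/seteqP; split => // g.
by rewrite /sepset /= eqxx.
Qed.

Lemma sepC x y : sepset x y = sepset y x.
Proof. by apply/seteqP; split => g; rewrite /sepset /= eq_sym. Qed.

Lemma sepNr x y : y != 0 -> mu (sepset x (- y)) = 1 - mu (sepset x y).
Proof.
move=> y0; rewrite -(meanC mumean).
apply: (mean_eq_off_null mumean (mean_strip mumean 0 y0)) => g /= /negP.
rewrite normr_le0 => gy; rewrite /sepset /= dotpNr oppr_ge0.
case: (ltrgtP (dotp (lat R g) y) 0) gy => // _ _;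
  by case: (0 <= _); split => // /(_ isT).
Qed.

Lemma sepNl x y : x != 0 -> mu (sepset (- x) y) = 1 - mu (sepset x y).
Proof. by move=> x0; rewrite sepC sepNr // sepC. Qed.

(** The mean is invariant under a lattice injection close to [rho], and the
    two hyperplane tests agree outside of null strips. *)
Lemma sep_isometry rho x y : lattice_isometry rho -> x != 0 -> y != 0 ->
  mu (sepset (rho x) (rho y)) = mu (sepset x y).
Proof.
move=> [[T [C [K [Tinj _ TC _]]]] rhoE] x0 y0.
have rhoN z : eucl_norm (rho z) = eucl_norm z by rewrite /eucl_norm rhoE.
have [C' hC] := exists_nat_ge C.
rewrite -(mean_preimage mumean (T := T) (C := C')) //; last first.
  move=> g; rewrite -(subrK (rho (lat R g)) (lat R (T g))) addrC.
  apply: le_trans (eucl_normD _ _) _; rewrite rhoN lerD2l.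
  exact: le_trans (TC g) hC.
have agree z g : C * eucl_norm z < `|dotp (lat R g) z| ->
    (0 <= dotp (lat R (T g)) (rho z)) = (0 <= dotp (lat R g) z).
  move=> far; have : `|dotp (lat R (T g)) (rho z) - dotp (lat R g) z| <= C * eucl_norm z.
    rewrite -[dotp (lat R g) z]rhoE -dotpBl; apply: le_trans (cauchy_schwarz_dotp _ _) _.
    by rewrite rhoN ler_wpM2r ?eucl_norm_ge0.
  exact: same_sign_near far.
have null := mean_setU_null mumean
  (mean_strip mumean (C * eucl_norm x) x0) (mean_strip mumean (C * eucl_norm y) y0).
apply: (mean_eq_off_null mumean null) => g /not_orP[/= /negP gx /negP gy].
by rewrite /sepset /= !agree // ltNge.
Qed.

(** A hyperplane separates [x] from [z] iff it separates exactly one of the two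
    pairs that they form with a vector [y] between them. *)
Lemma sep_between x y z a b c : 0 < c -> 0 <= a -> 0 <= b -> 0 < a + b ->
  c *: y = a *: x + b *: z ->
  mu (sepset x z) = mu (sepset x y) + mu (sepset y z).
Proof.
move=> c0 a0 b0 ab E.
have dE g : c * dotp (lat R g) y = a * dotp (lat R g) x + b * dotp (lat R g) z.
  by rewrite -!dotpZr E dotpDr.
have tri g : (0 <= dotp (lat R g) x) = (0 <= dotp (lat R g) z) ->
    (0 <= dotp (lat R g) y) = (0 <= dotp (lat R g) x).
  case: (ltP (dotp (lat R g) x)) => gx; case: (ltP (dotp (lat R g) z)) => gz // _.
    apply/negbTE; rewrite -ltNge -(pmulr_rlt0 _ c0) dE.
    have [a1|a1] := ltP 0 a.
      by rewrite ltr_nwDl ?pmulr_rlt0 // mulr_ge0_le0 // ltW.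
    have b1 : 0 < b by lra.
    by rewrite ltr_wnDl ?pmulr_rlt0 // mulr_ge0_le0 // ltW.
  by rewrite -(pmulr_rge0 _ c0) dE addr_ge0 // mulr_ge0.
rewrite -(meanU mumean).
  congr mu; apply/seteqP; split => g; rewrite /sepset /=; have := tri g;
    case: (0 <= dotp _ x); case: (0 <= dotp _ z); case: (0 <= dotp _ y) => //= h;
    by [left|right|case|have := h erefl].
apply/seteqP; split => // g [] /=; rewrite /sepset /=; have := tri g.
by case: (0 <= dotp _ x); case: (0 <= dotp _ z); case: (0 <= dotp _ y) => //= /(_ erefl).
Qed.

(** The point of angle [a] of the unit circle of the coordinate plane [i, j]. *)
Definition circle_pt (i j : 'I_N) (a : R) : 'rV[R]_N :=
  cos a *: delta_mx 0 i + sin a *: delta_mx 0 j.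

Lemma circle_pt0 i j : circle_pt i j 0 = delta_mx 0 i.
Proof. by rewrite /circle_pt cos0 sin0 scale1r scale0r addr0. Qed.

Lemma circle_pt_pi i j : circle_pt i j pi = - delta_mx 0 i.
Proof. by rewrite /circle_pt cospi sinpi scaleN1r scale0r addr0. Qed.

Lemma delta_mx_neq0 (i : 'I_N) : (delta_mx 0 i : 'rV[R]_N) != 0.
Proof. by apply/eqP => /rowP /(_ i); rewrite !mxE !eqxx => /eqP; rewrite oner_eq0. Qed.

Lemma circle_pt_neq0 i j a : i != j -> circle_pt i j a != 0.
Proof.
move=> ij; apply/eqP => /rowP E; have := E i; have := E j.
rewrite !mxE !eqxx (eq_sym j i) (negbTE ij) /= !mulr1 !mulr0 add0r addr0 => s0 c0.
by have := cos2Dsin2 a; rewrite s0 c0 expr0n /= addr0 => /eqP; rewrite eq_sym oner_eq0.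
Qed.

Lemma sep_circle_rot i j a b : i != j -> cos a != -1 ->
  mu (sepset (circle_pt i j a) (circle_pt i j b))
  = mu (sepset (delta_mx 0 i) (circle_pt i j (b - a))).
Proof.
move=> ij ca.
rewrite -(sep_isometry (lattice_isometry_givens ij (cos2Dsin2 a) ca));
  rewrite ?circle_pt_neq0 //.
have G d : givens i j (cos a) (sin a) (circle_pt i j d) = circle_pt i j (d - a).
  apply/rowP => k; rewrite /circle_pt !mxE !eqxx (eq_sym j i) (negbTE ij) /=.
  rewrite cosB sinB; case: (eqVneq k i) => [->|ki].
    by rewrite (negbTE ij) /=; ring.
  by case: (k == j) => /=; ring.
by rewrite !G subrr circle_pt0.
Qed.

(** Invariance under rotations and [sep_between] make the separation probability
    additive in the angle. *)
Lemma sep_arc i j a : i != j -> 0 <= a <= pi ->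
  mu (sepset (delta_mx 0 i) (circle_pt i j a)) = a / pi.
Proof.
move=> ij; move: a; apply: (@additive_itv_linear R pi
  (fun a => mu (sepset (delta_mx 0 i) (circle_pt i j a)))); first exact: pi_gt0.
- by move=> b _; exact: (mean_ge0 mumean).
- move=> a b a0 b0 abpi.
  have [->|an0] := eqVneq a 0.
    by rewrite add0r circle_pt0 sep_refl add0r.
  have [api|api] := eqVneq a pi.
    have -> : b = 0 by move: abpi; rewrite api; lra.
    by rewrite addr0 circle_pt0 sep_refl addr0.
  have ap : 0 < a by rewrite lt_neqAle eq_sym an0.
  have {}api : a < pi by rewrite lt_neqAle api; lra.
  have ca : cos a != -1.
    rewrite -cospi (inj_in_eq (@cos_inj R)) ?in_itv /= ?a0 ?pi_ge0 ?lexx ?ltW //.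
    by rewrite lt_eqF.
  have -> : mu (sepset (delta_mx 0 i) (circle_pt i j b))
      = mu (sepset (circle_pt i j a) (circle_pt i j (a + b))).
    by rewrite sep_circle_rot // addrC addKr.
  have [abE|abN] := eqVneq (a + b) pi.
    rewrite abE circle_pt_pi !sepNr ?delta_mx_neq0 // sep_refl.
    by rewrite (sepC (circle_pt _ _ _)); lra.
  have sab : 0 < sin (a + b).
    by apply: sin_gt0_pi; rewrite ltr_pwDl //= lt_neqAle abN.
  have sa : 0 < sin a by apply: sin_gt0_pi; rewrite ap.
  have sb : 0 <= sin b by apply: sin_ge0_pi; rewrite b0; lra.
  apply: (@sep_between _ _ _ (sin b) (sin a) _ sab) => //.
  - exact: ltW.
  - exact: ltr_wpDl.
  have c2 : cos a ^+ 2 = 1 - sin a ^+ 2 by rewrite -(cos2Dsin2 a) addrK.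
  rewrite /circle_pt !scalerDr !scalerA addrA -scalerDl (mulrC (sin a) (sin _)).
  congr (_ *: _ + _); rewrite sinD cosD.
  have -> : (sin a * cos b + cos a * sin b) * cos a
    = sin a * cos a * cos b + cos a ^+ 2 * sin b by ring.
  by rewrite c2; ring.
by rewrite circle_pt_pi sepNr ?delta_mx_neq0 // sep_refl subr0.
Qed.

End Separation.

(** The invariant mean realizes the geodesic distance as the probability of
    being separated by a hyperplane. *)
Lemma sep_geo_dist (R : realType) N (mu : set 'rV[int]_N -> R) (x y : 'rV[R]_N) :
  lattice_mean mu -> eucl_norm x = 1 -> eucl_norm y = 1 ->
  mu (sepset x y) = geo_dist x y.
Proof.
move=> mumean x1 y1.
have nz (z : 'rV[R]_N) : eucl_norm z = 1 -> z != 0.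
  move=> z1; apply: contra_eq_neq z1 => ->.
  by rewrite -(scale0r 0) eucl_normZ normr0 mul0r eq_sym oner_eq0.
have ppi : pi != 0 :> R by rewrite gt_eqF // pi_gt0.
have [rho [i [a [rhoi rx ry]]]] := pair_normal_form y (nz _ x1).
rewrite -(sep_isometry mumean rhoi) ?nz // /geo_dist -rhoi.2.
have xx : dotp (rho x) (rho x) = 1 by rewrite rhoi.2 -sqr_eucl_norm x1 expr1n.
have yy : dotp (rho y) (rho y) = 1 by rewrite rhoi.2 -sqr_eucl_norm y1 expr1n.
have ei : dotp (delta_mx 0 i : 'rV[R]_N) (delta_mx 0 i) = 1.
  by rewrite dotp_delta mxE !eqxx.
have key (z : 'rV[R]_N) : dotp z z = 1 ->
    (exists b, z = b *: delta_mx 0 i) \/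
    (exists j b c, [/\ i != j, c != 0 & z = b *: delta_mx 0 i + c *: delta_mx 0 j]) ->
    mu (sepset (delta_mx 0 i) z) = acos (dotp (delta_mx 0 i) z) / pi.
  move=> zz [[b zb]|[j [b [c [ij c0 zb]]]]].
    move: zz; rewrite zb !dotpZl !dotpZr ei mulr1 -expr2 => /eqP.
    rewrite sqrf_eq1 => /orP[] /eqP ->.
      by rewrite scale1r acos1 mul0r sep_refl.
    by rewrite scaleN1r acosN1 sepNr ?delta_mx_neq0 // sep_refl // subr0 divff.
  have ej : dotp (delta_mx 0 j : 'rV[R]_N) (delta_mx 0 j) = 1.
    by rewrite dotp_delta mxE !eqxx.
  have eij : dotp (delta_mx 0 i : 'rV[R]_N) (delta_mx 0 j) = 0.
    by rewrite dotp_delta mxE eqxx eq_sym (negbTE ij).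
  have bc : b ^+ 2 + c ^+ 2 = 1.
    move: zz; rewrite zb !dotpDl !dotpDr !dotpZl !dotpZr (dotpC (delta_mx 0 j)).
    by rewrite ei ej eij !mulr0 addr0 add0r !mulr1.
  have c2 : 0 < c ^+ 2 by rewrite lt_def sqr_ge0 sqrf_eq0 c0.
  have b1 : -1 < b < 1 by rewrite -ltr_norml -(@expr_lt1 _ 2) // real_normK ?num_real //; lra.
  have /andP[bl br] := b1.
  have bI : -1 <= b <= 1 by rewrite !ltW.
  have -> : dotp (delta_mx 0 i) z = b.
    by rewrite zb dotpDr !dotpZr ei eij mulr1 mulr0 addr0.
  set t := acos b.
  have ct : cos t = b by rewrite acosK // in_itv.
  have t0 : 0 <= t <= pi by rewrite acos_ge0 // acos_lepi.
  have st : sin t ^+ 2 = c ^+ 2.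
    by have := cos2Dsin2 t; rewrite ct; lra.
  move/eqP: st; rewrite eqf_sqr => /orP[] /eqP st.
    by rewrite -(sep_arc mumean ij t0) /circle_pt ct st zb.
  have -> : z = circle_pt i j (- t) by rewrite /circle_pt cosN sinN ct st opprK zb.
  have ctN : cos (- t) != -1 by rewrite cosN ct gt_eqF.
  have := sep_circle_rot mumean 0 ij ctN.
  by rewrite circle_pt0 sub0r opprK sep_arc // sepC.
have : a ^+ 2 == 1 by rewrite -xx rx dotpZl dotpZr ei mulr1 -expr2.
rewrite sqrf_eq1 rx => /orP[] /eqP ->; first by rewrite scale1r key.
rewrite scaleN1r sepNl ?delta_mx_neq0 // key // dotpNl acosN.
  by rewrite mulrBl divff.
rewrite -ler_norml; apply: le_trans (cauchy_schwarz_dotp _ _) _.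
by rewrite eucl_norm_delta mul1r /eucl_norm yy sqrtr1.
Qed.

(** * Concentration for averages of independent signs *)

Lemma ge0_derive_ge0 (R : realType) (f f' : R -> R) :
  (forall u : R, is_derive u 1 f (f' u)) -> (forall u, 0 <= u -> 0 <= f' u) ->
  f 0 = 0 -> forall t, 0 <= t -> 0 <= f t.
Proof.
move=> df f'0 f0 t t0; rewrite -[leLHS]f0.
apply: (@ger0_derive1_ndecry R f 0) => //.
- by move=> x; rewrite in_itv /= andbT => x0; rewrite derive1E derive_val f'0 // ltW.
- apply: continuous_subspaceT => x.
  by apply/differentiable_continuous/derivable1_diffP; have [] := df x.
Qed.

(** Hoeffding's bound for the exponential moment of a Bernoulli variable. *)
Lemma hoeffding_bernoulli (R : realType) (p t : R) : 0 <= p <= 1 -> 0 <= t ->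
  1 - p + p * expR t <= expR (t * p + t ^+ 2 / 8).
Proof.
move=> /andP[p0 p1] t0.
pose D (u : R) : R := 1 - p + p * expR u.
have Dpos u : 0 < D u.
  rewrite /D; have := expR_gt0 u; move: (expR u) => e e0.
  have [->|pn0] := eqVneq p 0; first by rewrite subr0 mul0r addr0.
  by rewrite ltr_wpDl ?subr_ge0 // mulr_gt0 // lt_neqAle eq_sym pn0.
have Dn0 u : D u != 0 by rewrite gt_eqF.
have dD (u : R) : is_derive u 1 D (p * expR u).
  rewrite (_ : D = cst (1 - p) + p \*: expR) //.
  by apply: is_derive_eq; rewrite add0r.
have dlin (c u : R) : is_derive u 1 (fun v : R => v * c) c.
  rewrite (_ : (fun _ => _) = c \*: id); last by apply/funext => v /=; rewrite mulrC.
  by apply: is_derive_eq; rewrite /GRing.scale /= mulr1.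
(* [k] is the derivative of [g], and its own derivative is nonnegative because
   [4 a b <= (a + b) ^ 2] *)
pose g (u : R) : R := u * p + u ^+ 2 / 8 - ln (D u).
pose k (u : R) : R := p + u / 4 - 1 + (1 - p) / D u.
have k0 u : 0 <= u -> 0 <= k u.
  apply: (@ge0_derive_ge0 R k (fun v => 4^-1 - (1 - p) * (p * expR v) / D v ^+ 2)).
  - move=> v; have dV := is_deriveV (Dn0 v) (dD v).
    rewrite (_ : k = cst (p - 1) + (fun v => v * 4^-1) + (1 - p) \*: (fun y => (D y)^-1)).
      apply: is_derive_eq; rewrite add0r /GRing.scale /= mulNr mulrN.
      by rewrite -[in RHS]mulrA [in RHS](mulrC (p * _)).
    apply/funext => w; rewrite /k !fctE /GRing.scale /=.
    by congr (_ + _); rewrite addrAC.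
  - move=> v _; rewrite subr_ge0 ler_pdivrMr ?exprn_gt0 //.
    rewrite /D; move: (p * expR v) => q.
    have := sqr_ge0 (1 - p - q); nra.
  - by rewrite /k /D expR0 mul0r addr0 mulr1 subrK divr1; ring.
have g0 : 0 <= g t.
  have dg (u : R) : is_derive u 1 g (k u).
    have dL := is_derive1_comp (is_derive1_ln (Dpos u)) (dD u).
    have d2 : is_derive u 1 (fun v : R => v ^+ 2 / 8) (u / 4).
      rewrite (_ : (fun _ => _) = 8^-1 \*: (id ^+ 2)).
        by apply: is_derive_eq; rewrite /GRing.scale /=; field.
      by apply/funext => v /=; rewrite mulrC.
    apply: is_derive_eq (is_deriveB (is_deriveD (dlin p u) d2) dL) _.
    rewrite /k /D; have := Dn0 u; rewrite /D; move: (expR u) => e De.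
    by field.
  apply: (ge0_derive_ge0 dg k0 _ t0).
  by rewrite /g /D expR0 mul0r expr0n mul0r addr0 mulr1 subrK ln1 subr0.
have : ln (D t) <= t * p + t ^+ 2 / 8 by move: g0; rewrite /g subr_ge0.
by rewrite -ler_expR lnK ?posrE.
Qed.

(** One-sided Hoeffding inequality for [m] independent draws from the finite
    distribution [w], by the exponential Markov inequality. *)
Lemma hoeffding_tail (R : realType) (I : finType) (w : I -> R) (e : pred I)
    (m : nat) (delta p : R) :
  (forall b, 0 <= w b) -> \sum_b w b = 1 -> p = \sum_(b | e b) w b ->
  0 <= delta ->
  \sum_(B : {ffun 'I_m -> I} | m%:R * delta < \sum_(i < m) ((e (B i))%:R - p))
    \prod_i w (B i) <= expR (- (2 * m%:R * delta ^+ 2)).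
Proof.
move=> w0 w1 pE d0.
have p01 : 0 <= p <= 1.
  rewrite pE sumr_ge0 //= -w1 [leRHS](bigID e) /= lerDl; exact: sumr_ge0.
(* the exponent that minimizes [l ^+ 2 / 8 - l * delta] *)
pose l : R := 4 * delta.
have l0 : 0 <= l by rewrite mulr_ge0.
pose z b : R := expR (l * ((e b)%:R - p)).
have W0 (B : {ffun 'I_m -> I}) : 0 <= \prod_i w (B i) by apply: prodr_ge0.
have Ez : \sum_b w b * z b <= expR (l ^+ 2 / 8).
  have -> : \sum_b w b * z b = expR (- (l * p)) * (1 - p + p * expR l).
    have qE : 1 - p = \sum_(b | ~~ e b) w b.
      by rewrite -w1 (bigID e) /= -pE addrAC subrr add0r.
    rewrite (bigID e) /= (eq_bigr (fun b => w b * expR (l * (1 - p)))) => [|b eb].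
      rewrite [X in _ + X](eq_bigr (fun b => w b * expR (l * (0 - p)))) => [|b eb].
        rewrite -!mulr_suml -pE -qE sub0r mulrN mulrBr mulr1 expRD; ring.
      by rewrite /z (negbTE eb).
    by rewrite /z eb.
  apply: le_trans (ler_wpM2l (expR_ge0 _) (hoeffding_bernoulli p01 l0)) _.
  by rewrite -expRD ler_expR addrA addNr add0r.
apply: (@le_trans _ _ (\sum_(B : {ffun 'I_m -> I})
    (\prod_i (w (B i) * z (B i))) * expR (- (m%:R * (l * delta))))).
  rewrite big_mkcond; apply: ler_sum => B _.
  rewrite [X in _ <= X * _]big_split /= -[leRHS]mulrA; case: ifP => [lt|_]; last first.
    apply: mulr_ge0; [exact: W0|apply: mulr_ge0]; last exact: expR_ge0.
    by apply: prodr_ge0 => i _; exact: expR_ge0.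
  rewrite -[leLHS]mulr1; apply: ler_wpM2l; first exact: W0.
  rewrite -expR_sum -expRD -[leLHS]expR0 ler_expR -mulr_sumr.
  rewrite subr_ge0 mulrCA; by apply: ler_wpM2l => //; exact: ltW.
rewrite -mulr_suml -(bigA_distr_bigA (fun (i : 'I_m) b => w b * z b)) /= prodr_const card_ord.
have le1 : (\sum_b w b * z b) ^+ m <= expR (m%:R * (l ^+ 2 / 8)).
  rewrite expRM_natl lerXn2r ?nnegrE ?expR_ge0 //.
  by apply: sumr_ge0 => b _; rewrite mulr_ge0 // expR_ge0.
apply: le_trans (ler_wpM2r (expR_ge0 _) le1) _.
rewrite -expRD ler_expR /l le_eqVlt; apply/orP; left; apply/eqP.
by field.
Qed.

(** Union bound: for some sequence of [m] outcomes, the empirical frequencies of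
    finitely many events are simultaneously close to their probabilities. *)
Lemma exists_empirical_frequencies (R : realType) (I J : finType) (w : I -> R)
    (Q : pred J) (e : J -> pred I) (m : nat) (delta : R) :
  (forall b, 0 <= w b) -> \sum_b w b = 1 -> 0 < delta -> (0 < m)%N ->
  2 * #|Q|%:R * expR (- (2 * m%:R * delta ^+ 2)) < 1 ->
  exists B : {ffun 'I_m -> I}, forall j, Q j ->
    `|#|[set i : 'I_m | e j (B i)]%SET|%:R / m%:R - \sum_(b | e j b) w b| <= delta.
Proof.
move=> w0 w1 d0 m0 small; apply: contrapT => /forallNP nB.
pose p j := \sum_(b | e j b) w b.
pose up j (B : {ffun 'I_m -> I}) :=
  m%:R * delta < \sum_(i < m) ((e j (B i))%:R - p j).
pose lo j (B : {ffun 'I_m -> I}) :=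
  m%:R * delta < \sum_(i < m) ((~~ e j (B i))%:R - (1 - p j)).
have W0 (B : {ffun 'I_m -> I}) : 0 <= \prod_i w (B i) by apply: prodr_ge0.
have m0' : 0 < m%:R :> R by rewrite ltr0n.
have bad B : exists2 j, Q j & up j B || lo j B.
  have /existsNP[j /not_implyP[Qj /negP]] := nB B.
  rewrite -ltNge => lt; exists j => //.
  have cE : \sum_(i < m) ((e j (B i))%:R - p j)
     = #|[set i : 'I_m | e j (B i)]%SET|%:R - m%:R * p j.
    rewrite big_split /= sumr_const card_ord mulNrn mulr_natl; congr (_ - _).
    rewrite -sum1_card natr_sum [RHS]big_mkcond /=.
    by apply: eq_bigr => i _; rewrite inE; case: (e _ _).
  have upE : up j B = (delta < #|[set i : 'I_m | e j (B i)]%SET|%:R / m%:R - p j).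
    by rewrite /up cE -[RHS](ltr_pM2l m0') mulrBr [m%:R * (_ / _)]mulrCA divff ?gt_eqF // mulr1.
  have loE : lo j B = (delta < - (#|[set i : 'I_m | e j (B i)]%SET|%:R / m%:R - p j)).
    rewrite /lo -[RHS](ltr_pM2l m0') mulrN mulrBr [m%:R * (_ / _)]mulrCA divff ?gt_eqF //.
    rewrite mulr1 -cE.
    suff -> : \sum_(i < m) ((~~ e j (B i))%:R - (1 - p j))
        = - \sum_(i < m) ((e j (B i))%:R - p j) by [].
    by rewrite -[RHS]sumrN; apply: eq_bigr => i _; case: (e _ _) => /=; ring.
  by rewrite upE loE -ltr_normr.
have total : \sum_(B : {ffun 'I_m -> I}) \prod_i w (B i) = 1.
  rewrite -(bigA_distr_bigA (fun (i : 'I_m) b => w b)) /=.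
  by rewrite big1 // => i _.
have pC j : 1 - p j = \sum_(b | ~~ e j b) w b.
  by rewrite /p -w1 (bigID (e j)) /= addrAC subrr add0r.
have : 1 <= \sum_(j | Q j) (\sum_(B | up j B) \prod_i w (B i)
                          + \sum_(B | lo j B) \prod_i w (B i)).
  rewrite -[leLHS]total.
  under [leRHS]eq_bigr do rewrite big_mkcond [X in _ + X]big_mkcond -big_split /=.
  rewrite exchange_big /=; apply: ler_sum => B _.
  have [j Qj ul] := bad B.
  rewrite (bigD1 j) //= -[leLHS]addr0 lerD //.
    case: ifP ul => _ /=; first by rewrite lerDl; case: ifP.
    by move=> ->; rewrite add0r.
  by apply: sumr_ge0 => k _; rewrite addr_ge0 //; case: ifP.
apply/negP; rewrite -ltNge; apply: le_lt_trans small.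
have -> : 2 * #|Q|%:R * expR (- (2 * m%:R * delta ^+ 2))
  = \sum_(j | Q j) (expR (- (2 * m%:R * delta ^+ 2)) + expR (- (2 * m%:R * delta ^+ 2))).
  by rewrite sumr_const -[RHS]mulr_natl; ring.
apply: ler_sum => j _; apply: lerD.
  by apply: (hoeffding_tail (e := e j)) => //; exact: ltW.
by apply: (hoeffding_tail (e := fun b => ~~ e j b)) => //; exact: ltW.
Qed.

(** * Hyperplane tests chosen at random *)

(** Additivity over the fibres of a map into a finite type. *)
Lemma mean_finite_map (R : realType) N (mu : set 'rV[int]_N -> R) (I : finType)
    (P : 'rV[int]_N -> I) (S : pred I) : lattice_mean mu ->
  \sum_(b | S b) mu (P @^-1` [set b]) = mu [set g | S (P g)].
Proof.
move=> mumean.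
have gen (s : seq I) : uniq s ->
    \sum_(b <- s | S b) mu (P @^-1` [set b]) = mu [set g | (P g \in s) && S (P g)].
  elim: s => [_|b s IH /= /andP[bs us]].
    by rewrite big_nil -(mean_set0 mumean); congr mu; apply/seteqP; split.
  rewrite big_cons IH //; case: ifP => Sb.
    rewrite -(meanU mumean).
      congr mu; apply/seteqP; split => g /=; rewrite in_cons.
        by move=> [->|/andP[-> ->]]; rewrite ?eqxx ?orbT.
      by move=> /andP[/orP[/eqP|->] ->]; [left|right].
    by apply/seteqP; split => // g [/= ->]; rewrite (negbTE bs).
  congr mu; apply/seteqP; split => g /=; rewrite in_cons.
    by move=> /andP[-> ->]; rewrite orbT.
  by move=> /andP[/orP[/eqP ->|->] //]; rewrite Sb.
rewrite (gen _ (index_enum_uniq _)); congr mu; apply/seteqP; split => g /=.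
  by move=> /andP[].
by move=> ->; rewrite mem_index_enum.
Qed.

Lemma card_offdiag (T : finType) :
  #|[pred xy : T * T | xy.1 != xy.2]| = (#|T| * #|T|.-1)%N.
Proof.
rewrite -sum1_card.
rewrite (eq_bigl (fun xy : T * T => true && (xy.1 != xy.2))) //.
rewrite -(pair_big_dep xpredT (fun x y : T => x != y) (fun _ _ => 1%N)) /=.
rewrite -sum_nat_const; apply: eq_bigr => x _; rewrite sum1_card.
by rewrite -(cardC1 x); apply: eq_card => y; rewrite !inE eq_sym.
Qed.

Theorem mainTheorem1 (R : realType) (delta : R) (n m : nat)
    (hdelta0 : 0 < delta) (hdelta1 : delta < 1)
    (hn : (1 <= n)%N) (hm0 : (0 < m)%N)
    (hm : 2 * ln (n%:R : R) / delta ^+ 2 < m%:R) :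
  forall (N : nat), (1 <= N)%N ->
  forall X : {fset 'rV[R]_N}, [set` X] `<=` unit_sphere R N -> #|` X|%fset = n ->
  exists f : X -> hamming_cube m,
    is_RIP (fun x y : X => geo_dist (val x) (val y)) (hamming_dist R) delta f.
Proof.
move=> N _ X Xsphere Xn.
have [mu mumean] := exists_lattice_mean R N.
have Xunit (x : X) : eucl_norm (val x) = 1 by apply: Xsphere; exact: valP.
have n0 : 0 < n%:R :> R by rewrite ltr0n.
(* the pattern of signs on [X] *)
pose P (g : 'rV[int]_N) : {ffun X -> bool} := [ffun x => 0 <= dotp (lat R g) (val x)].
have freq (x y : X) :
    \sum_(b : {ffun X -> bool} | b x != b y) mu (P @^-1` [set b])
    = geo_dist (val x) (val y).
  rewrite (mean_finite_map P (fun b => b x != b y) mumean).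
  rewrite -(sep_geo_dist mumean) //; congr mu; apply/seteqP.
  by split => g; rewrite /sepset /= !ffunE.
have small : 2 * #|[pred xy : X * X | xy.1 != xy.2]|%:R
    * expR (- (2 * m%:R * delta ^+ 2)) < 1.
  have le1 : expR (- (2 * m%:R * delta ^+ 2)) <= (n ^ 4)%:R^-1.
    rewrite -[leRHS]lnK ?posrE ?invr_gt0 ?ltr0n ?expn_gt0 ?hn //.
    rewrite ler_expR lnV ?posrE ?ltr0n ?expn_gt0 ?hn // lerN2 natrX lnXn //.
    move: hm; rewrite ltr_pdivrMr ?exprn_gt0 // => hm'.
    by rewrite -[_ *+ 4]mulr_natl; lra.
  apply: le_lt_trans (ler_wpM2l _ le1) _; first by rewrite mulr_ge0.
  rewrite ltr_pdivrMr ?ltr0n ?expn_gt0 ?hn // mul1r -natrM ltr_nat.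
  rewrite card_offdiag -cardfE Xn; case: (n) hn => // k _ /=.
  rewrite !expnS expn0; nia.
have total : \sum_(b : {ffun X -> bool}) mu (P @^-1` [set b]) = 1.
  rewrite (mean_finite_map P xpredT mumean) -[RHS](meanT mumean).
  by congr mu; apply/seteqP; split.
have [B HB] := exists_empirical_frequencies
  (fun (xy : X * X) (b : {ffun X -> bool}) => b xy.1 != b xy.2) (fun b => mean_ge0 mumean _) total
  hdelta0 hm0 small.
exists (fun x => [tuple B i x | i < m]) => x y.
have [<-|xy] := eqVneq x y.
  have -> : geo_dist (val x) (val x) = 0.
    by rewrite -(sep_geo_dist mumean) // sep_refl.
  rewrite subr0 /hamming_dist (_ : [set i | _]%SET = finset.set0).
    by rewrite cards0 mul0r normr0 ltW.
  by apply/finset.setP => i; rewrite !inE eqxx.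
have := HB (x, y) xy; rewrite freq /hamming_dist.
congr (`|_%:R / _ - _| <= _); apply: eq_card => i; rewrite !inE.
by rewrite !tnth_mktuple.
Qed.
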